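(* Let $n$ and $k$ be integers with $0<k<n$, and let $\delta_1,\ldots,\delta_n$ be distinct real numbers. Then there exists a unique vector $\vec c=(c_1,\ldots,c_n)\in\mathbb{R}^n$ such that $$\sum_{j=1}^n c_j\delta_j^i=0\quad\text{for all integers } 0\le i\le n-1,\ i\ne k,\qquad\text{and}\qquad \sum_{j=1}^n c_j\delta_j^k=k!.$$ Moreover, for this $\vec c$, for every non-zero real $h$, every real $t$, and every real-valued function $f$ that is $(n-1)$-times differentiable on an open interval containing $t$ and all the points $t+\delta_j h$ ($1\le j\le n$), one has $$\frac{1}{h^k}\sum_{j=1}^n c_j f(t+\delta_j h)=f^{(k)}(t)+\frac{1}{h^k}\sum_{j=1}^n c_j R_{n,j},$$ where $R_{n,j}$ denotes the Taylor remainder defined by $f(t+\delta_j h)=\left(\sum_{i=0}^{n-1} f^{(i)}(t)\frac{\delta_j^i h^i}{i!}\right)+R_{n,j}$.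
   Context: The convention $\delta^0=1$ is used for every real $\delta$, including $\delta=0$. $f^{(i)}$ is the $i$th derivative of $f$, with $f^{(0)}=f$. *)

(* Defs.v *)
From HB Require Import structures.
From mathcomp Require Import all_boot all_order all_algebra.
From mathcomp Require Import all_classical all_reals all_analysis.
Set Implicit Arguments.
Unset Strict Implicit.
Unset Printing Implicit Defensive.
Import Order.TTheory GRing.Theory Num.Theory.
Import numFieldNormedType.Exports.
Local Open Scope classical_set_scope.
Local Open Scope ring_scope.

(* [x ^+ 0] is [1] for every [x], so the convention [0 ^ 0 = 1] is built in. *)
Definition derivative_weights (R : realType) (n k : nat)
    (delta : 'I_n -> R) (c : 'rV[R]_n) : Prop :=
  (forall i : nat, (i <= n - 1)%N -> i != k ->
     \sum_(j < n) c ord0 j * delta j ^+ i = 0) /\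
  \sum_(j < n) c ord0 j * delta j ^+ k = k`!%:R.

(* [derive1] is a total operator, so differentiability of every lower-order
   derivative has to be required as well.  When [I] is open, only the values
   of [f] on [I] matter: those outside [I] are arbitrary. *)
Definition times_derivable_on (R : realType) (m : nat) (f : R -> R)
    (I : set R) : Prop :=
  forall i : nat, (i < m)%N -> forall x : R, I x -> derivable (f^`(i))%classic x 1.

(* Main.v *)
Require Import Defs.
From HB Require Import structures.
From mathcomp Require Import all_boot all_order all_algebra.
From mathcomp Require Import all_classical all_reals all_analysis.
From mathcomp Require Import ring.
Import Order.TTheory GRing.Theory Num.Theory.
Import numFieldNormedType.Exports.
Local Open Scope classical_set_scope.
Local Open Scope ring_scope.

(** The conditions on [c] say that [c *m V^T] is [k!] times the [k]-th unit
    row vector, where [V] is the Vandermonde matrix of the nodes [delta]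
    ([derivative_weightsP]).  Distinct nodes make [V] invertible
    ([Vandermonde_unitmx]), so exactly one [c] satisfies them.

    For the finite-difference formula, substitute the Taylor expansions into
    [\sum_j c_j f(t + delta_j h)] and exchange the two sums: the coefficient
    of [f^(i)(t) h^i / i!] is the [i]-th moment [\sum_j c_j delta_j^i], hence
    only the term [i = k] survives and it equals [f^(k)(t) h^k]
    ([derivative_weights_taylor]). *)

Lemma Vandermonde_unitmx (F : fieldType) (n : nat) (a : 'rV[F]_n) :
  injective (a ord0) -> Vandermonde n a \in unitmx.
Proof.
move=> a_inj; rewrite unitmxE det_Vandermonde unitfE.
apply/prodf_neq0 => i _; apply/prodf_neq0 => j lt_ij.
rewrite subr_eq0; apply/eqP => /a_inj eq_ji.
by rewrite eq_ji ltnn in lt_ij.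
Qed.

Lemma derivative_weightsP (R : realType) (n k : nat) (delta : 'I_n -> R)
    (k_lt_n : (k < n)%N) (c : 'rV[R]_n) :
  derivative_weights k delta c <->
  c *m (Vandermonde n (\row_j delta j))^T =
    k`!%:R *: delta_mx ord0 (Ordinal k_lt_n).
Proof.
have momentE (i : 'I_n) : (c *m (Vandermonde n (\row_j delta j))^T) ord0 i =
    \sum_(j < n) c ord0 j * delta j ^+ i.
  by rewrite mxE; apply: eq_bigr => j _; rewrite !mxE.
have rhsE (i : 'I_n) :
    (k`!%:R *: delta_mx ord0 (Ordinal k_lt_n) : 'rV[R]_n) ord0 i =
    if val i == k then k`!%:R else 0.
  rewrite !mxE eqxx -val_eqE /=.
  by case: (val i == k); rewrite ?mulr1 ?mulr0.
split=> [[moment0 momentk]|eqc].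
  apply/rowP => i; rewrite momentE rhsE; case: eqP => [->//|/eqP ik].
  by apply: moment0 => //; rewrite leq_subRL ?add1n ?ltn_ord // (leq_trans _ k_lt_n).
split=> [i le_in ik|].
  have lt_in : (i < n)%N.
    by rewrite -add1n -leq_subRL // (leq_trans _ k_lt_n).
  by rewrite -(momentE (Ordinal lt_in)) eqc rhsE (negPf ik).
by rewrite -(momentE (Ordinal k_lt_n)) eqc rhsE eqxx.
Qed.

(** A linear functional with these moments picks out [k`! * a k] from the
    values of the polynomial with coefficients [a] at the nodes; the
    coefficients are scaled here as in a Taylor expansion of step [h]. *)
Lemma derivative_weights_taylor (R : realType) (n k : nat) (delta : 'I_n -> R)
    (c : 'rV[R]_n) (h : R) (d : nat -> R) :
  (k < n)%N -> derivative_weights k delta c ->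
  \sum_(j < n) c ord0 j *
     (\sum_(0 <= i < n) d i * (delta j ^+ i * h ^+ i / i`!%:R)) =
  d k * h ^+ k.
Proof.
move=> k_lt_n [moment0 momentk].
transitivity (\sum_(i < n) d i * h ^+ i / i`!%:R *
                (\sum_(j < n) c ord0 j * delta j ^+ i)).
  under eq_bigr => j _ do rewrite big_mkord mulr_sumr.
  rewrite exchange_big; apply: eq_bigr => i _ /=.
  rewrite mulr_sumr; apply: eq_bigr => j _.
  by ring.
rewrite (bigD1 (Ordinal k_lt_n)) //= momentk big1 ?addr0 => [|i ik].
  by rewrite divfK // pnatr_eq0 -lt0n fact_gt0.
rewrite moment0 ?mulr0 //.
by rewrite leq_subRL ?add1n ?ltn_ord // (leq_trans _ k_lt_n).
Qed.

Theorem mainTheorem1 (R : realType) (n k : nat) (delta : 'I_n -> R)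
    (k_gt0 : (0 < k)%N) (k_lt_n : (k < n)%N) (delta_inj : injective delta) :
  (exists! c : 'rV[R]_n, derivative_weights k delta c) /\
  (forall c : 'rV[R]_n, derivative_weights k delta c ->
     forall (h t : R) (f : R -> R) (I : set R),
       h != 0 -> open I -> is_interval I -> I t ->
       (forall j : 'I_n, I (t + delta j * h)) ->
       times_derivable_on (n - 1) f I ->
       forall Rem : 'I_n -> R,
         (forall j : 'I_n,
            f (t + delta j * h) =
              \sum_(0 <= i < n) (f^`(i))%classic t * (delta j ^+ i * h ^+ i / i`!%:R)
              + Rem j) ->
         (h ^+ k)^-1 * \sum_(j < n) c ord0 j * f (t + delta j * h) =
           (f^`(k))%classic t + (h ^+ k)^-1 * \sum_(j < n) c ord0 j * Rem j).
Proof.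
split; last first.
  move=> c cw h t f I h0 _ _ _ _ _ Rem taylorE.
  under eq_bigr => j _ do rewrite taylorE mulrDr.
  rewrite big_split /=.
  rewrite (derivative_weights_taylor _ _ k _ _ _ (fun i => f^`(i)%classic t)) //.
  rewrite mulrDr mulrCA.
  by rewrite mulVf ?mulr1 // expf_neq0.
set V := Vandermonde n (\row_j delta j).
have Vunit : V^T \in unitmx.
  rewrite unitmx_tr; apply: Vandermonde_unitmx => i j.
  by rewrite !mxE => /delta_inj.
exists (k`!%:R *: delta_mx ord0 (Ordinal k_lt_n) *m invmx V^T); split.
  by apply/(derivative_weightsP _ _ _ _ k_lt_n); rewrite mulmxKV.
by move=> c /(derivative_weightsP _ _ _ _ k_lt_n) <-; rewrite mulmxK.
Qed.
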